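(* Let $\mathcal{P}$ be a non-overlapping PTRS. Then $\mathrm{edc}_{\xrightarrow{\mathbf{li}}_{\mathcal{P}}}=\mathrm{edc}_{\xrightarrow{\mathbf{i}}_{\mathcal{P}}}$ and $\mathrm{erc}_{\xrightarrow{\mathbf{li}}_{\mathcal{P}}}=\mathrm{erc}_{\xrightarrow{\mathbf{i}}_{\mathcal{P}}}$.
   Context: Terms over countable signature and variables. Finite multi-distributions $\mathrm{FDist}(A)$: finite multisets of pairs $(p:a)$, $0<p\le1$, probabilities summing to 1; $\mathrm{Supp}$, $p\cdot\mu$ as usual. A PTRS is a countable set of rules $\ell\to\mu$, $\ell$ non-variable, $\mu\in\mathrm{FDist}$ of terms, variables of each $r\in\mathrm{Supp}(\mu)$ among those of $\ell$. $s\to_{\mathcal{P}}\{p_1:t_1,\dots,p_k:t_k\}$ at position $\pi$ if $s|_\pi=\ell\sigma$, $t_j=s[r_j\sigma]_\pi$ for a rule $\ell\to\{p_1:r_1,\dots,p_k:r_k\}$; innermost ($\xrightarrow{\mathbf{i}}_{\mathcal{P}}$) if all proper subterms of $\ell\sigma$ are normal forms; leftmost-innermost ($\xrightarrow{\mathbf{li}}_{\mathcal{P}}$) if innermost and there is no redex at a position parallel to and left of $\pi$. Lifting $\rightrightarrows$ of $\to$: smallest relation on multi-distributions with $\{1:t\}\rightrightarrows\{1:t\}$ for normal forms, $\{1:t\}\rightrightarrows\mu$ if $t\to\mu$, closed under convex combinations $\bigcup_jp_j\cdot\mu_j\rightrightarrows\bigcup_jp_j\cdot\nu_j$. $|\mu|_\to$: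 total probability of normal forms; $\mathrm{edl}((\mu_n))=\sum_n(1-|\mu_n|_\to)$; $\mathrm{edh}_\to(t)=\sup$ of $\mathrm{edl}$ over infinite $\rightrightarrows$-sequences from $\{1:t\}$. Size $|x|=1$, $|f(t_1..t_k)|=1+\sum|t_i|$. $\mathrm{edc}_\to(n)=\sup\{\mathrm{edh}_\to(t)\mid|t|\le n\}$; $\mathrm{erc}_\to(n)=\sup\{\mathrm{edh}_\to(t)\mid t$ basic, $|t|\le n\}$, where basic terms are $f(t_1,\dots,t_k)$ with $f$ the root of some left-hand side of $\mathcal{P}$ and the $t_i$ containing no such symbols. Non-overlapping: no two rules (renamed apart) and non-variable position $\pi$ of the first left-hand side such that its subterm at $\pi$ unifies with the second left-hand side ($\pi\ne\varepsilon$ if same rule). *)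

(* Defs.v *)
From HB Require Import structures.
From mathcomp Require Import all_boot all_order all_algebra.
From mathcomp Require Import finmap multiset.
From mathcomp Require Import all_classical all_reals all_analysis.

Set Implicit Arguments.
Unset Strict Implicit.
Unset Printing Implicit Defensive.

Import Order.TTheory GRing.Theory Num.Theory.

Local Open Scope mset_scope.
Local Open Scope classical_set_scope.
Local Open Scope ring_scope.

(** * Terms *)

Inductive term (F : Type) (ar : F -> nat) (V : Type) : Type :=
| Var of V
| App (f : F) of ('I_(ar f) -> term ar V).

Arguments Var {F ar V} _.
Arguments App {F ar V} f _.

HB.instance Definition _ (F : Type) (ar : F -> nat) (V : Type) :=
  gen_eqMixin (term ar V).
HB.instance Definition _ (F : Type) (ar : F -> nat) (V : Type) :=
  gen_choiceMixin (term ar V).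

Section Terms.
Context {F : Type} {ar : F -> nat}.

Definition is_var (V : Type) (t : term ar V) : bool :=
  if t is Var _ then true else false.

Fixpoint tsize (V : Type) (t : term ar V) : nat :=
  match t with
  | Var _ => 1%N
  | App f ts => (1 + \sum_(i < ar f) tsize (ts i))%N
  end.

Fixpoint tvars (V : Type) (t : term ar V) : set V :=
  match t with
  | Var x => [set x]
  | App f ts => \bigcup_(i in [set: 'I_(ar f)]) tvars (ts i)
  end.

Fixpoint tsymbols (V : Type) (t : term ar V) : set F :=
  match t with
  | Var _ => set0
  | App f ts => f |` \bigcup_(i in [set: 'I_(ar f)]) tsymbols (ts i)
  end.

Fixpoint tsubst (V W : Type) (sigma : V -> term ar W) (t : term ar V) :
    term ar W :=
  match t with
  | Var x => sigma x
  | App f ts => App f (fun i => tsubst sigma (ts i))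
  end.

Definition trename (V W : Type) (h : V -> W) : term ar V -> term ar W :=
  tsubst (fun x => Var (h x)).

(* Positions are sequences of argument indices counted from 0; [None] means
   that the position does not exist in the term. *)
Fixpoint subterm_at (V : Type) (t : term ar V) (pi : seq nat) :
    option (term ar V) :=
  match pi, t with
  | [::], _ => Some t
  | i :: pi', Var _ => None
  | i :: pi', App f ts =>
      if insub i is Some j then subterm_at (ts j) pi' else None
  end.

Fixpoint replace_at (V : Type) (t : term ar V) (pi : seq nat) (u : term ar V) :
    term ar V :=
  match pi, t with
  | [::], _ => u
  | i :: pi', Var _ => t
  | i :: pi', App f ts =>
      App f (fun j : 'I_(ar f) =>
        if val j == i then replace_at (ts j) pi' u else ts j)
  end.

End Terms.

Definition left_of (pi1 pi2 : seq nat) : Prop :=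
  exists (tau pi1' pi2' : seq nat) (i j : nat),
    [/\ pi1 = tau ++ i :: pi1', pi2 = tau ++ j :: pi2' & (i < j)%N].

(** * Finite multi-distributions *)

Section MultiDistributions.
Context {R : realType}.

Definition is_fdist (A : choiceType) (mu : {mset R * A}) : Prop :=
  (forall x, x \in mu -> 0 < x.1 <= 1) /\ \sum_(x <- mu) x.1 = 1.

Definition msupp (A : choiceType) (mu : {mset R * A}) : set A :=
  [set a | exists p : R, (p, a) \in mu].

Definition mdirac (A : choiceType) (a : A) : {mset R * A} := [mset (1, a)].

Definition mscale (A : choiceType) (p : R) (mu : {mset R * A}) :
    {mset R * A} :=
  seq_mset [seq (p * x.1, x.2) | x <- mu].

Definition mmap (A B : choiceType) (f : A -> B) (mu : {mset R * A}) :
    {mset R * B} :=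
  seq_mset [seq (x.1, f x.2) | x <- mu].

(* The union of multisets adds multiplicities, hence [msetD]; [msetU] takes
   their maximum. *)
Definition mconvex (A : choiceType) (k : nat) (p : 'I_k -> R)
    (mu : 'I_k -> {mset R * A}) : {mset R * A} :=
  \big[msetD/mset0]_(j < k) mscale (p j) (mu j).

End MultiDistributions.

(** * Expected derivation length of an abstract probabilistic reduction *)

Section Lifting.
Context {R : realType} {A : choiceType}.
Variable red : A -> {mset R * A} -> Prop.

Definition normal_form (t : A) : Prop := ~ exists mu, red t mu.

Inductive lifting : {mset R * A} -> {mset R * A} -> Prop :=
| lifting_nf t : normal_form t -> lifting (mdirac t) (mdirac t)
| lifting_red t mu : red t mu -> lifting (mdirac t) mu
| lifting_convex (k : nat) (p : 'I_k -> R) (mu nu : 'I_k -> {mset R * A}) :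
    (forall j, 0 < p j <= 1) -> \sum_(j < k) p j = 1 ->
    (forall j, lifting (mu j) (nu j)) ->
    lifting (mconvex p mu) (mconvex p nu).

Definition nf_mass (mu : {mset R * A}) : R :=
  \sum_(x <- mu | `[< normal_form x.2 >]) x.1.

Definition edl (mu : nat -> {mset R * A}) : \bar R :=
  (\sum_(0 <= n <oo) (1 - nf_mass (mu n))%:E)%E.

Definition lifting_sequence (t : A) (mu : nat -> {mset R * A}) : Prop :=
  mu 0%N = mdirac t /\ forall n, lifting (mu n) (mu n.+1).

Definition edh (t : A) : \bar R := ereal_sup (edl @` lifting_sequence t).

End Lifting.

(* Supremum in [0, +oo]: the supremum of the empty set is 0 instead of -oo. *)
Definition nneg_sup (R : realType) (X : set (\bar R)) : \bar R :=
  ereal_sup (0%E |` X).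

(** * Probabilistic term rewriting *)

Section PTRS.
Context {R : realType} {F : Type} {ar : F -> nat} {V : Type}.

Notation T := (term ar V).
Notation D := {mset R * term ar V}.

Definition is_rule (r : T * D) : Prop :=
  [/\ ~~ is_var r.1,
      is_fdist r.2 &
      forall t, msupp r.2 t -> tvars t `<=` tvars r.1].

Definition is_ptrs (P : set (T * D)) : Prop :=
  countable P /\ forall r, P r -> is_rule r.

Variable P : set (T * D).

Definition rewrite_at (s : T) (pi : seq nat) (l : T) (rho : D)
    (sigma : V -> T) (mu : D) : Prop :=
  [/\ P (l, rho),
      subterm_at s pi = Some (tsubst sigma l) &
      mu = mmap (fun r => replace_at s pi (tsubst sigma r)) rho].

Definition rew (s : T) (mu : D) : Prop :=
  exists pi l rho sigma, rewrite_at s pi l rho sigma mu.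

Definition irew_at (s : T) (pi : seq nat) (mu : D) : Prop :=
  exists l rho sigma, rewrite_at s pi l rho sigma mu /\
    forall tau u, tau <> [::] -> subterm_at (tsubst sigma l) tau = Some u ->
      normal_form rew u.

Definition irew (s : T) (mu : D) : Prop := exists pi, irew_at s pi mu.

Definition redex_at (s : T) (pi : seq nat) : Prop :=
  exists l rho sigma, P (l, rho) /\ subterm_at s pi = Some (tsubst sigma l).

Definition lirew (s : T) (mu : D) : Prop :=
  exists pi, irew_at s pi mu /\
    ~ exists tau, left_of tau pi /\ redex_at s tau.

(* The two rules are renamed apart by moving their variables into the two
   summands of [V + V]. *)
Definition overlap (r1 r2 : T * D) (pi : seq nat) : Prop :=
  exists (u : T) (sigma : V + V -> term ar (V + V)),
    [/\ subterm_at r1.1 pi = Some u,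
        ~~ is_var u,
        (r1 = r2 -> pi <> [::]) &
        tsubst sigma (trename inl u) = tsubst sigma (trename inr r2.1)].

Definition non_overlapping : Prop :=
  ~ exists r1 r2 pi, [/\ P r1, P r2 & overlap r1 r2 pi].

Definition defined_symbol (f : F) : Prop :=
  exists (ts : 'I_(ar f) -> T) (rho : D), P (App f ts, rho).

Definition basic (t : T) : Prop :=
  exists (f : F) (ts : 'I_(ar f) -> T),
    [/\ t = App f ts, defined_symbol f &
        forall i g, tsymbols (ts i) g -> ~ defined_symbol g].

Definition edc (red : T -> D -> Prop) (n : nat) : \bar R :=
  nneg_sup (edh red @` [set t | (tsize t <= n)%N]).

Definition erc (red : T -> D -> Prop) (n : nat) : \bar R :=
  nneg_sup (edh red @` [set t | basic t /\ (tsize t <= n)%N]).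

End PTRS.

(* Main.v *)
(** Let [L n t] be the expected number of leftmost-innermost steps from [t]
    among the first [n] ones; it is computed recursively because, without
    overlaps, the leftmost-innermost step is unique. Every innermost step
    [t -> mu] satisfies [1 + E_mu[L n] <= L n.+1 t], by induction on [n]: if it
    is not the leftmost one, the two contracted redexes are parallel, the two
    steps commute, and their expectations can be exchanged. Summing this
    inequality along an innermost sequence bounds its first [n] expected steps
    by [L n t], which is the value reached by the leftmost-innermost sequence,
    so the comparison already holds for partial sums. *)

Require Import Defs.
From mathcomp Require Import all_boot all_order all_algebra.
From mathcomp Require Import finmap multiset.
From mathcomp Require Import all_classical all_reals all_analysis.

Set Implicit Arguments.
Unset Strict Implicit.
Unset Printing Implicit Defensive.

Import Order.TTheory GRing.Theory Num.Theory.

Local Open Scope mset_scope.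
Local Open Scope classical_set_scope.
Local Open Scope ring_scope.

(** * Expectations over finite multi-distributions *)

Section Expectation.
Context {R : realType}.
Implicit Types A B : choiceType.

Lemma perm_msetD (K : choiceType) (M N : {mset K}) :
  perm_eq (msetD M N) (M ++ N).
Proof. by apply/allP => a _ /=; rewrite count_cat !count_mem_mset msetE2. Qed.

Definition mexp A (f : A -> R) (mu : {mset R * A}) : R :=
  \sum_(x <- mu) x.1 * f x.2.

Lemma mexp_mmap A B (g : A -> B) (f : B -> R) (mu : {mset R * A}) :
  mexp f (mmap g mu) = mexp (f \o g) mu.
Proof. by rewrite /mexp (perm_big _ (perm_eq_seq_mset _)) big_map. Qed.

Lemma mexp_mscale A (f : A -> R) p (mu : {mset R * A}) :
  mexp f (Defs.mscale p mu) = p * mexp f mu.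
Proof.
rewrite /mexp (perm_big _ (perm_eq_seq_mset _)) big_map mulr_sumr.
by apply: eq_bigr => x _; rewrite mulrA.
Qed.

Lemma mexp_mconvex A (f : A -> R) k (p : 'I_k -> R) (mu : 'I_k -> {mset R * A}) :
  mexp f (mconvex p mu) = \sum_(j < k) p j * mexp f (mu j).
Proof.
rewrite /mconvex (big_morph (mexp f) (id1 := 0) (op1 := +%R)).
- by apply: eq_bigr => j _; exact: mexp_mscale.
- by move=> M N; rewrite /mexp (perm_big _ (perm_msetD _ _)) big_cat.
- by rewrite /mexp big_mset0.
Qed.

Lemma mexp_mdirac A (f : A -> R) a : mexp f (mdirac a) = f a.
Proof. by rewrite /mexp big_msetn /= mul1r. Qed.

Lemma mexpD A (f g : A -> R) (mu : {mset R * A}) :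
  mexp (fun a => f a + g a) mu = mexp f mu + mexp g mu.
Proof. by rewrite -big_split; apply: eq_bigr => x _; rewrite mulrDr. Qed.

Lemma eq_mexp A (f g : A -> R) (mu : {mset R * A}) :
  f =1 g -> mexp f mu = mexp g mu.
Proof. by move=> fg; apply: eq_bigr => x _; rewrite fg. Qed.

Lemma le_mexp A (f g : A -> R) (mu : {mset R * A}) :
  is_fdist mu -> (forall a, f a <= g a) -> mexp f mu <= mexp g mu.
Proof.
move=> [mu01 _] fg; rewrite /mexp !big_seq.
by apply: ler_sum => x /mu01/andP[x0 _]; rewrite ler_wpM2l// ltW.
Qed.

Lemma mexp_cst A c (mu : {mset R * A}) : is_fdist mu -> mexp (fun=> c) mu = c.
Proof. by move=> [_ mu1]; rewrite /mexp -mulr_suml mu1 mul1r. Qed.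

Lemma mexp_exchange A B (f : A -> B -> R) (mu : {mset R * A}) (nu : {mset R * B}) :
  mexp (fun a => mexp (f a) nu) mu = mexp (fun b => mexp (f^~ b) mu) nu.
Proof.
rewrite /mexp; under eq_bigr do rewrite mulr_sumr.
rewrite exchange_big; apply: eq_bigr => y _; rewrite mulr_sumr.
by apply: eq_bigr => x _; rewrite mulrCA.
Qed.

Lemma is_fdist_mdirac A (a : A) : is_fdist (mdirac a : {mset R * A}).
Proof.
split=> [x|]; last by rewrite big_msetn.
by rewrite in_mset msetnE; case: eqP => // ->; rewrite ltr01 lexx.
Qed.

Lemma is_fdist_mmap A B (g : A -> B) (mu : {mset R * A}) :
  is_fdist mu -> is_fdist (mmap g mu).
Proof.
move=> [mu01 mu1]; split=> [x|].
  rewrite -[x \in _]/(x \in enum_mset _) (perm_mem (perm_eq_seq_mset _)).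
  by move=> /mapP[y ymu ->]; exact: mu01.
by rewrite (perm_big _ (perm_eq_seq_mset _)) big_map.
Qed.

Lemma is_fdist_mconvex A k (p : 'I_k -> R) (mu : 'I_k -> {mset R * A}) :
  (forall j, 0 < p j <= 1) -> \sum_(j < k) p j = 1 ->
  (forall j, is_fdist (mu j)) -> is_fdist (mconvex p mu).
Proof.
move=> p01 p1 muF; split=> [|].
  rewrite /mconvex; elim/big_ind: _ => [x|M N IM IN x|j _ x].
  - by rewrite in_mset mset0E.
  - rewrite -[x \in _]/(x \in enum_mset _) (perm_mem (perm_msetD _ _)) mem_cat.
    by move=> /orP[/IM|/IN].
  - rewrite -[x \in _]/(x \in enum_mset _) (perm_mem (perm_eq_seq_mset _)).
    move=> /mapP[y /(proj1 (muF j))/andP[y0 y1] ->] /=.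
    have /andP[pj0 pj1] := p01 j.
    by rewrite mulr_gt0// mulr_ile1// ltW.
(* The total mass is the expectation of the constant 1, so linearity of [mexp] reduces it to the sum
   of the [p j]. *)
transitivity (mexp (fun=> 1) (mconvex p mu)).
  by rewrite /mexp; apply: eq_bigr => x _; rewrite mulr1.
rewrite mexp_mconvex -[RHS]p1; apply: eq_bigr => j _.
by rewrite mexp_cst// mulr1.
Qed.

(** Splitting a distribution into Dirac components lets [lifting_convex] step each of its entries
    separately. *)
Lemma seq_mset_mconvex A (s : seq (R * A)) :
  seq_mset s = mconvex (fun j : 'I_(size s) => (tnth (in_tuple s) j).1)
                       (fun j => mdirac (tnth (in_tuple s) j).2).
Proof.
apply/msetP => y.
rewrite -count_mem_mset (permP (perm_eq_seq_mset s)) /mconvex.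
rewrite (big_morph (fun M : {mset R * A} => M y) (id1 := 0%N) (op1 := addn)).
- rewrite -[X in count _ X]/(tval (in_tuple s)) -sum1_count big_tnth big_mkcond /=.
  apply: eq_bigr => j _; rewrite -count_mem_mset (permP (perm_eq_seq_mset _)).
  rewrite enum_msetn /= addn0 mulr1 -surjective_pairing.
  by case: eqP.
- by move=> M N; rewrite msetE2.
- by rewrite mset0E.
Qed.

End Expectation.

(** * Existence of lifted sequences, and the probability of not being in normal form *)

Section Lifting.
Context {R : realType} {A : choiceType}.
Implicit Types (red : A -> {mset R * A} -> Prop) (mu nu : {mset R * A}).

Lemma lifting_is_fdist red mu nu :
  (forall t rho, red t rho -> is_fdist rho) ->
  lifting red mu nu -> is_fdist mu /\ is_fdist nu.
Proof.
move=> redF; elim=> {mu nu} [t _|t mu tmu|k p mu nu p01 p1 _ IH].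
- by split; exact: is_fdist_mdirac.
- by split; [exact: is_fdist_mdirac|exact: redF tmu].
- by split; apply: is_fdist_mconvex => // j; case: (IH j).
Qed.

Lemma lifting_total red mu : is_fdist mu -> exists nu, lifting red mu nu.
Proof.
move=> [mu01 mu1].
have [next nextP] : {next : A -> {mset R * A} &
    forall a, lifting red (mdirac a) (next a)}.
  apply: (@choice _ _ (fun a nu => lifting red (mdirac a) nu)) => a.
  have [[nu anu]|nfa] := pselect (exists nu, red a nu).
    by exists nu; exact: lifting_red.
  by exists (mdirac a); exact: lifting_nf.
set s : seq (R * A) := mu.
have muE : mu = seq_mset s.
  by apply/msetP => x; rewrite -!count_mem_mset (permP (perm_eq_seq_mset _)).
rewrite muE seq_mset_mconvex.
exists (mconvex (fun j => (tnth (in_tuple s) j).1)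
                (fun j => next (tnth (in_tuple s) j).2)).
apply: lifting_convex => [j||j]; last exact: nextP.
  by apply: mu01; exact: mem_tnth.
by rewrite -[RHS]mu1 [RHS]big_tnth.
Qed.

Lemma lifting_sequence_exists red t :
  (forall t rho, red t rho -> is_fdist rho) ->
  exists mu : nat -> {mset R * A}, lifting_sequence red t mu.
Proof.
(* The default [mset0] is never taken: every iterate is a distribution, and distributions always
   have a lifted successor. *)
move=> redF; pose step mu := xget mset0 (lifting red mu).
exists (fun n => iter n step (mdirac t)); split=> // n.
suff muF : is_fdist (iter n step (mdirac t)).
  by rewrite iterS; apply: xgetPex; exact: lifting_total.
elim: n => [|n IHn]; first exact: is_fdist_mdirac.
by have /= := xgetPex mset0 (lifting_total red IHn) => /(lifting_is_fdist redF)[].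
Qed.

(** Writing [1 - nf_mass] as the expectation of an indicator makes it linear under [mconvex], as the
    inductions on [lifting] require. *)
Definition live red (a : A) : R := (~~ `[< normal_form red a >])%:R.

Lemma mexp_live red mu : is_fdist mu -> mexp (live red) mu = 1 - nf_mass red mu.
Proof.
move=> [_ mu1]; rewrite -mu1 /nf_mass (bigID (fun x => `[< normal_form red x.2 >])) /=.
rewrite [X in _ = X - _]addrC addrK [RHS]big_mkcond; apply: eq_bigr => x _ /=.
by rewrite /live; case: asboolP => _ /=; rewrite (mulr0, mulr1).
Qed.

Lemma lifting_sequence_live_ge0 red t (mu : nat -> {mset R * A}) n :
  (forall t rho, red t rho -> is_fdist rho) ->
  lifting_sequence red t mu -> (0 <= (1 - nf_mass red (mu n))%:E :> \bar R)%E.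
Proof.
move=> redF [_ muS]; have [muF _] := lifting_is_fdist redF (muS n).
by rewrite lee_fin -mexp_live// -(mexp_cst 0 muF) le_mexp.
Qed.

End Lifting.

(** * Comparison of a deterministic strategy with the relation it restricts *)

Section Strategy.
Context {R : realType} {A : choiceType}.
Variables strat red : A -> {mset R * A} -> Prop.
Hypothesis strat_red : forall t mu, strat t mu -> red t mu.
Hypothesis strat_complete : forall t mu, red t mu -> exists nu, strat t nu.
Hypothesis red_fdist : forall t mu, red t mu -> is_fdist mu.
Hypothesis strat_det : forall t mu nu, strat t mu -> strat t nu -> mu = nu.
(** Abstract form of two commuting steps with independent random outcomes [b] and [c]: [h b c] is
    reached by performing both, in either order. *)
Hypothesis diamond : forall t mu nu, red t mu -> strat t nu ->
  mu = nu \/ exists (B : choiceType) (rho rho' : {mset R * B})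
    (f g : B -> A) (h : B -> B -> A),
    [/\ is_fdist rho /\ is_fdist rho', mu = mmap f rho, nu = mmap g rho',
        forall b, strat (f b) (mmap (h b) rho') &
        forall c, red (g c) (mmap (h^~ c) rho)].

Let strat_fdist t mu : strat t mu -> is_fdist mu.
Proof. by move/strat_red/red_fdist. Qed.

Lemma strategy_normal_form : normal_form strat = normal_form red.
Proof.
apply/funext => t; apply/propext; split=> nft [mu tmu]; apply: nft.
  exact: strat_complete tmu.
by exists mu; exact: strat_red.
Qed.

(* Expected number of [strat]-steps from [t] among the first [n]. *)
Fixpoint expected_steps (n : nat) (t : A) : R :=
  if n is m.+1 then
    if `[< normal_form strat t >] then 0
    else 1 + mexp (expected_steps m) (xget mset0 (strat t))
  else 0.

Lemma expected_steps_nf n t : normal_form strat t -> expected_steps n t = 0.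
Proof. by case: n => // n nft; rewrite /= ifT//; exact/asboolP. Qed.

Lemma expected_stepsS n t mu :
  strat t mu -> expected_steps n.+1 t = 1 + mexp (expected_steps n) mu.
Proof.
move=> tmu; rewrite /= ifF; last first.
  by apply/negbTE/asboolPn => -[]; exists mu.
by rewrite (xget_unique _ tmu)// => nu /strat_det; exact.
Qed.

Lemma expected_steps_red n t mu :
  red t mu -> 1 + mexp (expected_steps n) mu <= expected_steps n.+1 t.
Proof.
elim: n t mu => [|n IHn] t mu tmu; have [nu tnu] := strat_complete tmu.
  (* With no further steps counted, both sides equal 1. *)
  rewrite (expected_stepsS _ tnu).
  by rewrite !mexp_cst//; [exact: strat_fdist tnu|exact: red_fdist tmu].
rewrite (expected_stepsS _ tnu) lerD2l.
have [->//|[B [rho [rho' [f [g [h [[rhoF rhoF'] -> -> fh gh]]]]]]]] :=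
  diamond tmu tnu.
rewrite !mexp_mmap.
(* From every [f b] the strategy performs the step with outcomes in [rho'], so the left side becomes
   1 plus a double expectation. *)
rewrite (eq_mexp _ (fun b => expected_stepsS n (fh b))).
rewrite mexpD mexp_cst//.
under eq_mexp do rewrite mexp_mmap.
(* With [rho'] outermost and the 1 absorbed into its expectation, the induction hypothesis applies
   at each [g c]. *)
rewrite mexp_exchange -[X in X + _](mexp_cst 1 rhoF') -mexpD.
apply: le_mexp => // c.
by have := IHn _ _ (gh c); rewrite mexp_mmap.
Qed.

(** All terms are expectations, so induction on [lifting] leaves single elements: normal forms
    contribute 0, and steps are handled by [expected_steps_red]. *)
Lemma lifting_expected_steps_le n mu nu : lifting red mu nu ->
  1 - nf_mass red mu + mexp (expected_steps n) nu <= mexp (expected_steps n.+1) mu.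
Proof.
move=> munu; rewrite -mexp_live; last by case: (lifting_is_fdist red_fdist munu).
elim: munu => {mu nu} [t nft|t mu tmu|k p mu nu p01 p1 _ IH].
- rewrite !mexp_mdirac !expected_steps_nf ?strategy_normal_form// addr0.
  by rewrite /live asboolT.
- rewrite !mexp_mdirac /live asboolF; last by case; exists mu.
  exact: expected_steps_red.
- rewrite !mexp_mconvex -big_split /=; apply: ler_sum => j _.
  by rewrite -mulrDr ler_wpM2l//; case/andP: (p01 j) => /ltW.
Qed.

Lemma lifting_expected_steps_eq n mu nu : lifting strat mu nu ->
  1 - nf_mass strat mu + mexp (expected_steps n) nu = mexp (expected_steps n.+1) mu.
Proof.
move=> munu; rewrite -mexp_live; last by case: (lifting_is_fdist strat_fdist munu).
elim: munu => {mu nu} [t nft|t mu tmu|k p mu nu p01 p1 _ IH].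
- by rewrite !mexp_mdirac !expected_steps_nf// addr0 /live asboolT.
- rewrite !mexp_mdirac /live asboolF; last by case; exists mu.
  by rewrite (expected_stepsS _ tmu).
- rewrite !mexp_mconvex -big_split /=; apply: eq_bigr => j _.
  by rewrite -mulrDr IH.
Qed.

Lemma lifting_sequence_le t mu n : lifting_sequence red t mu ->
  \sum_(0 <= k < n) (1 - nf_mass red (mu k)) <= expected_steps n t.
Proof.
move=> [mu0 muS]; rewrite -(mexp_mdirac (expected_steps n)) -mu0.
(* The initial distribution is generalised so that the induction can pass to the sequence without
   its first element. *)
elim: n mu {mu0} muS => [|n IHn] mu muS.
  by rewrite big_geq//; have [/mexp_cst->] := lifting_is_fdist red_fdist (muS 0).
rewrite big_nat_recl//; apply: le_trans (lifting_expected_steps_le n (muS 0)).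
by rewrite lerD2l; apply: (IHn (mu \o S)) => k; exact: muS.
Qed.

(** Determinism turns the bound into an equality, so all sequences of the strategy share their
    partial sums. *)
Lemma strat_sequence_eq t mu n : lifting_sequence strat t mu ->
  \sum_(0 <= k < n) (1 - nf_mass strat (mu k)) = expected_steps n t.
Proof.
move=> [mu0 muS]; rewrite -(mexp_mdirac (expected_steps n)) -mu0.
elim: n mu {mu0} muS => [|n IHn] mu muS.
  by rewrite big_geq//; have [/mexp_cst->] := lifting_is_fdist strat_fdist (muS 0).
rewrite big_nat_recl// -(lifting_expected_steps_eq n (muS 0)).
by congr (_ + _); apply: (IHn (mu \o S)) => k; exact: muS.
Qed.

Lemma edh_strategy : edh strat = edh red.
Proof.
apply/funext => t; apply/eqP; rewrite eq_le; apply/andP; split.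
  (* Since normal forms coincide, a sequence of [strat] is also one of [red], with the same
     [edl]. *)
  apply: le_ereal_sup => _ [mu [mu0 muS] <-]; exists mu.
    split=> // n; elim: (muS n) => [a nfa|a nu anu|k p nu nu' p01 p1 _ IH].
    - by apply: lifting_nf; rewrite -strategy_normal_form.
    - by apply: lifting_red; exact: strat_red.
    - exact: lifting_convex.
  by rewrite /edl /nf_mass strategy_normal_form.
apply: ge_ereal_sup => _ [mu tmu <-].
have [nu tnu] := lifting_sequence_exists t strat_fdist.
apply: (@le_trans _ _ (edl strat nu)); last by apply: ereal_sup_ubound; exists nu.
(* It suffices to bound each partial sum for [red]: it is at most [expected_steps n t], which is a
   partial sum of the series for [nu]. *)
apply: lime_le => /=.
  by apply: is_cvg_nneseries => n _ _; exact: lifting_sequence_live_ge0 tmu.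
apply: nearW => n.
apply: (@le_trans _ _ (\sum_(0 <= k < n) (1 - nf_mass strat (nu k))%:E)%E).
  by rewrite !sumEFin lee_fin (strat_sequence_eq n tnu) lifting_sequence_le.
by apply: nneseries_lim_ge => k _ _; exact: lifting_sequence_live_ge0 tnu.
Qed.

End Strategy.

(** * Left-of and parallel positions *)

Fixpoint left_ofb (p q : seq nat) : bool :=
  match p, q with
  | i :: p', j :: q' => (i < j)%N || (i == j) && left_ofb p' q'
  | _, _ => false
  end.

Lemma left_ofP p q : reflect (left_of p q) (left_ofb p q).
Proof.
apply: (iffP idP) => [|[tau [p' [q' [i [j [-> -> ij]]]]]]]; last first.
  by elim: tau => [|k tau IH] /=; rewrite ?ij// eqxx IH orbT.
elim: p q => [|i p IHp] [|j q]//= /orP[ij|/andP[/eqP<- /IHp]].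
  by exists [::], p, q, i, j.
by case=> tau [p' [q' [k [l [-> -> kl]]]]]; exists (i :: tau), p', q', k, l.
Qed.

Lemma left_ofb_trans : transitive left_ofb.
Proof.
elim=> [|j q IHq] [|i p] [|k r]//= /orP[ij|/andP[/eqP-> pq]].
  by move=> /orP[/(ltn_trans ij)->//|/andP[/eqP<- _]]; rewrite ij.
move=> /orP[->//|/andP[->/=]]; rewrite orbC => qr.
by rewrite (IHq _ _ pq qr).
Qed.

Fixpoint parallel (p q : seq nat) : bool :=
  match p, q with
  | i :: p', j :: q' => (i != j) || parallel p' q'
  | _, _ => false
  end.

Lemma parallel_sym : symmetric parallel.
Proof. by elim=> [|i p IHp] [|j q]//=; rewrite eq_sym IHp. Qed.

Lemma left_of_parallel p q : left_ofb p q -> parallel p q.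
Proof.
elim: p q => [|i p IHp] [|j q]//= /orP[ij|/andP[_ /IHp->]]; last exact: orbT.
by rewrite neq_ltn ij.
Qed.

Lemma position_cases p q : left_ofb p q || left_ofb q p = false ->
  [\/ p = q, exists2 r, r <> [::] & q = p ++ r | exists2 r, r <> [::] & p = q ++ r].
Proof.
elim: p q => [|i p IHp] [|j q]//=.
- by constructor 1.
- by constructor 2; exists (j :: q).
- by constructor 3; exists (i :: p).
- case: (ltngtP i j) => //= <- /IHp[->|[r r0 ->]|[r r0 ->]].
  + by constructor 1.
  + by constructor 2; exists r.
  + by constructor 3; exists r.
Qed.

(** * Subterms, replacement and substitution *)

Section TermLemmas.
Context {F : Type} {ar : F -> nat}.

Lemma subterm_at_nil V (t : term ar V) : subterm_at t [::] = Some t.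
Proof. by case: t. Qed.

Lemma subterm_at_cat V (t u : term ar V) p q :
  subterm_at t p = Some u -> subterm_at t (p ++ q) = subterm_at u q.
Proof.
elim: p t => [|i p IHp] t /=; first by rewrite subterm_at_nil => -[->].
by case: t => [x//|f ts] /=; case: insub => // k; exact: IHp.
Qed.

Lemma subterm_at_replace V (t u : term ar V) p q :
  parallel p q -> subterm_at (replace_at t p u) q = subterm_at t q.
Proof.
elim: p t q => [|i p IHp] [x|f ts] [|j q]//= ipq.
case: insubP => // k _ kj; case: eqP => // ki.
by apply: IHp; move: ipq; rewrite -ki -kj eqxx.
Qed.

Lemma replace_at_comm V (t u v : term ar V) p q : parallel p q ->
  replace_at (replace_at t p u) q v = replace_at (replace_at t q v) p u.
Proof.
elim: p t q => [|i p IHp] [x|f ts] [|j q]//= ipq.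
congr App; apply/funext => k; case: (eqVneq (val k) j) => [kj|kj].
  case: (eqVneq (val k) i) => // ki.
  by apply: IHp; move: ipq; rewrite -ki -kj eqxx.
by case: eqP.
Qed.

(** The type of the arguments depends on [f]; reading them off by position avoids equalities of
    dependent pairs. *)
Lemma App_inj V f (ts ts' : 'I_(ar f) -> term ar V) :
  App f ts = App f ts' -> ts =1 ts'.
Proof.
move=> E i; have := congr1 (fun t => subterm_at t [:: val i]) E.
by rewrite /= valK !subterm_at_nil => -[].
Qed.

Lemma tsubst_inj V W (s s' : V -> term ar W) t :
  tsubst s t = tsubst s' t -> forall x, tvars t x -> s x = s' x.
Proof.
elim: t => [y /= E x ->//|f ts IH /= /App_inj E x [i _ tsx]].
exact: IH (E i) _ tsx.
Qed.

Lemma eq_tsubst V W (s s' : V -> term ar W) t :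
  (forall x, tvars t x -> s x = s' x) -> tsubst s t = tsubst s' t.
Proof.
elim: t => [y /= ->//|f ts IH E /=]; congr App; apply/funext => i.
by apply: IH => x tsx; apply: E; exists i.
Qed.

Lemma tsubst_trename V W U (h : V -> W) (s : W -> term ar U) t :
  tsubst s (trename h t) = tsubst (s \o h) t.
Proof.
by elim: t => [//|f ts IH] /=; congr App; apply/funext => i; exact: IH.
Qed.

Lemma trename_tsubst V W U (s : V -> term ar W) (h : W -> U) t :
  trename h (tsubst s t) = tsubst (trename h \o s) t.
Proof.
by elim: t => [//|f ts IH] /=; congr App; apply/funext => i; exact: IH.
Qed.

End TermLemmas.

Lemma eq_in_mmap (R : realType) (A B : choiceType) (f g : A -> B)
    (mu : {mset R * A}) :
  (forall a, msupp mu a -> f a = g a) -> mmap f mu = mmap g mu.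
Proof.
move=> fg; congr seq_mset; apply/eq_in_map => -[p a] amu /=.
by rewrite fg//; exists p.
Qed.

(** * Innermost and leftmost-innermost rewriting *)

Section Rewriting.
Context {R : realType} {F : Type} {ar : F -> nat} {V : Type}.
Variable P : set (term ar V * {mset R * term ar V}).
Implicit Types s t u : term ar V.

Lemma redex_at_rew t p : redex_at P t p -> exists mu, rew P t mu.
Proof.
move=> [l [rho [sigma [Pl tp]]]].
by eexists; exists p, l, rho, sigma; split.
Qed.

Lemma redex_at_cat t u p q :
  subterm_at t p = Some u -> redex_at P u q -> redex_at P t (p ++ q).
Proof.
move=> tp [l [rho [sigma [Pl uq]]]]; exists l, rho, sigma.
by rewrite (subterm_at_cat _ tp).
Qed.

Lemma redex_at_cons f (ts : 'I_(ar f) -> term ar V) i p :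
  redex_at P (App f ts) (i :: p) ->
  exists2 k : 'I_(ar f), val k = i & redex_at P (ts k) p.
Proof.
move=> [l [rho [sigma [Pl /=]]]]; case: insubP => // k _ ki tsk.
by exists k => //; exists l, rho, sigma.
Qed.

Lemma irew_at_redex t p mu : irew_at P t p mu -> redex_at P t p.
Proof. by move=> [l [rho [sigma [[Pl tp _] _]]]]; exists l, rho, sigma. Qed.

(** A redex strictly below an innermost redex would lie at a proper subterm, which has to be a
    normal form. *)
Lemma irew_at_antichain t p q mu nu :
  irew_at P t p mu -> irew_at P t (p ++ q) nu -> q = [::].
Proof.
move=> [l [rho [sigma [[_ tp _] nf]]]] [l' [rho' [sigma' [[Pl' tpq _] _]]]].
apply: contrapT => q0; rewrite (subterm_at_cat _ tp) in tpq.
apply: nf q0 tpq _; apply: (@redex_at_rew _ [::]).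
by exists l', rho', sigma'; rewrite subterm_at_nil.
Qed.

(** Innermost redexes are never nested, so distinct ones are parallel, and leftmostness of [q]
    decides their order. *)
Lemma lirew_position s p q mu nu :
  irew_at P s p mu -> irew_at P s q nu ->
  ~ (exists tau, left_of tau q /\ redex_at P s tau) ->
  p = q \/ left_ofb q p.
Proof.
move=> sp sq noleft; have [qp|qp] := boolP (left_ofb q p); first by right.
have [/left_ofP pq|pq] := boolP (left_ofb p q).
  by case: noleft; exists p; split => //; exact: irew_at_redex sp.
left; have /position_cases[//|[r r0 E]|[r r0 E]] :
  left_ofb p q || left_ofb q p = false by rewrite (negbTE pq) (negbTE qp).
- by case: r0; apply: irew_at_antichain sp _; rewrite -E; exact: sq.
- by case: r0; apply: irew_at_antichain sq _; rewrite -E; exact: sp.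
Qed.


Hypothesis rules : forall r, P r -> is_rule r.

(** Descending repeatedly into the leftmost argument that contains a redex ends at a
    leftmost-innermost redex. *)
Lemma redex_lirew t p : redex_at P t p -> exists mu, lirew P t mu.
Proof.
elim: t p => [x|f ts IH] p.
  move=> [l [rho [sigma [Pl]]]]; case: p => //= -[].
  by case: l Pl => [y /rules[]|].
have [[i [q iq]]|noarg] :=
    pselect (exists i : 'I_(ar f), exists q, redex_at P (ts i) q).
  move=> _.
  pose Q (i : 'I_(ar f)) := `[< exists q, redex_at P (ts i) q >].
  have Qi : Q i by apply/asboolP; exists q.
  case: (@arg_minnP _ i Q val Qi) => k /asboolP[r kr] kmin.
  have [mu [r' [[l [rho [sigma [[Pl tr _] nf]]]] noleft]]] := IH _ _ kr.
  eexists; exists (val k :: r'); split.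
    by exists l, rho, sigma; split => //; split => //=; rewrite valK.
  (* A redex further left lies either in an earlier argument, against the minimality of [k], or in
     [ts k] left of [r'], against the induction hypothesis. *)
  move=> [tau [/left_ofP]]; case: tau => // j tau /= jtau.
  move=> /redex_at_cons[m mj mtau].
  case/orP: jtau => [jk|/andP[/eqP jk /left_ofP tr']].
    have := kmin m; rewrite mj leqNgt jk => /(_ _)/negP; case=> //.
    by apply/asboolP; exists tau.
  have mk : m = k by apply: val_inj; rewrite mj.
  by apply: noleft; exists tau; split => //; rewrite -mk.
(* Without redexes in the arguments, the given redex is at the root and all its proper subterms are
   normal forms. *)
case: p => [|i p /redex_at_cons[k _ kp]]; last by case: noarg; exists k, p.
move=> [l [rho [sigma [Pl [tE]]]]].
eexists; exists [::]; split; last by case=> tau [/left_ofP]; case: tau.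
exists l, rho, sigma; split; first by split => //=; rewrite tE.
rewrite -tE => -[//|i tau] u _ /=; case: insub => // k ku [mu].
move=> [r [l' [rho' [sigma' [Pl' ur _]]]]]; apply: noarg; exists k, (tau ++ r).
by apply: redex_at_cat ku _; exists l', rho', sigma'.
Qed.

Lemma irew_lirew t mu : irew P t mu -> exists nu, lirew P t nu.
Proof. by move=> [p /irew_at_redex/redex_lirew]. Qed.

Lemma lirew_irew t mu : lirew P t mu -> irew P t mu.
Proof. by move=> [p [tp _]]; exists p. Qed.

Lemma irew_is_fdist t mu : irew P t mu -> is_fdist mu.
Proof.
move=> [p [l [rho [sigma [[/rules[_ rhoF _] _ ->] _]]]]].
exact: is_fdist_mmap.
Qed.

Hypothesis hno : non_overlapping P.

(** A common instance of two distinct rules would be an overlap at the root. *)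
Lemma non_overlapping_root r r' (sigma sigma' : V -> term ar V) :
  P r -> P r' -> tsubst sigma r.1 = tsubst sigma' r'.1 -> r = r'.
Proof.
move=> Pr Pr' E; apply: contrapT => rr'; apply: hno; exists r, r', [::].
split => //; exists r.1.
(* The two summands of [V + V] carry the two substitutions, whose values are embedded into terms
   over [V + V] by [inl]. *)
exists (fun x => trename inl
  match x with inl y => sigma y | inr y => sigma' y end).
split; [exact: subterm_at_nil|by have [] := rules Pr|by move=> /rr'|].
rewrite !tsubst_trename; have := congr1 (trename (@inl V V)) E.
by rewrite !trename_tsubst.
Qed.

(** The rule is unique, and matching fixes the substitution on the variables of its left-hand side,
    which include those of every right-hand side. *)
Lemma irew_at_det s p mu nu : irew_at P s p mu -> irew_at P s p nu -> mu = nu.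
Proof.
move=> [l [rho [sigma [[Pl sp ->] _]]]] [l' [rho' [sigma' [[Pl' sp' ->] _]]]].
move: sp'; rewrite sp => -[E].
have [ll' rr'] := non_overlapping_root Pl Pl' E; rewrite -{}ll' -{}rr' in E *.
apply: eq_in_mmap => r rho_r; congr replace_at; apply: eq_tsubst => x rx.
by apply: (tsubst_inj E); have [_ _] := rules Pl; apply; [exact: rho_r|].
Qed.

Lemma lirew_det s mu nu : lirew P s mu -> lirew P s nu -> mu = nu.
Proof.
move=> [p [sp leftp]] [q [sq leftq]].
have pq : p = q.
  have [//|qp] := lirew_position sp sq leftq.
  case: leftp; exists q; split; first exact/left_ofP.
  exact: irew_at_redex sq.
by rewrite pq in sp; exact: irew_at_det sp sq.
Qed.

(* A redex contracted by an innermost step elsewhere than at the leftmost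
   innermost position is parallel to it, so the two steps commute. *)
Lemma lirew_diamond s mu nu : irew P s mu -> lirew P s nu ->
  mu = nu \/ exists (B : choiceType) (rho rho' : {mset R * B})
    (f g : B -> term ar V) (h : B -> B -> term ar V),
    [/\ is_fdist rho /\ is_fdist rho', mu = mmap f rho, nu = mmap g rho',
        forall b, lirew P (f b) (mmap (h b) rho') &
        forall c, irew P (g c) (mmap (h^~ c) rho)].
Proof.
move=> [p sp] [q [sq leftq]].
have [pq|qp] := lirew_position sp sq leftq.
  by left; rewrite pq in sp; exact: irew_at_det sp sq.
right; have par := left_of_parallel qp.
move: sp sq => [l [rho [sigma [[Pl sp ->] nf]]]].
move=> [l' [rho' [sigma' [[Pl' sq ->] nf']]]].
(* The independent outcomes are the right-hand sides of the two rules. *)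
exists (term ar V), rho, rho', (fun r => replace_at s p (tsubst sigma r)),
  (fun r => replace_at s q (tsubst sigma' r)),
  (fun r r' => replace_at (replace_at s p (tsubst sigma r)) q (tsubst sigma' r')).
split=> [|//|//|r|r'].
- by have [_ ? _] := rules Pl; have [_ ? _] := rules Pl'.
- exists q; split.
    exists l', rho', sigma'; split => //; split => //.
    by rewrite subterm_at_replace// parallel_sym.
  (* A position [tau] left of [q] is also left of [p], so a redex there is unaffected by the
     contraction at [p] and was already present in [s]. *)
  move=> [tau [/left_ofP tauq [k [eta [theta [Pk stau]]]]]]; apply: leftq.
  exists tau; split; first exact/left_ofP.
  exists k, eta, theta; split => //; rewrite -stau subterm_at_replace//.
  by rewrite parallel_sym left_of_parallel// (left_ofb_trans tauq).
- exists p, l, rho, sigma; split => //; split => //.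
    by rewrite subterm_at_replace.
  by apply: eq_in_mmap => r _; rewrite replace_at_comm// parallel_sym.
Qed.

Lemma edh_lirew : edh (lirew P) = edh (irew P).
Proof.
exact: (edh_strategy lirew_irew irew_lirew irew_is_fdist lirew_det lirew_diamond).
Qed.

End Rewriting.

Theorem theorem4p13 (R : realType) (F : countType) (ar : F -> nat)
    (V : countType) (P : set (term ar V * {mset R * term ar V}))
    (hP : is_ptrs P) (hno : non_overlapping P) :
  edc (lirew P) = edc (irew P) /\ erc P (lirew P) = erc P (irew P).
(* Both complexities depend on the reduction only through [edh]. *)
Proof. by case: hP => _ rules; rewrite /edc /erc edh_lirew. Qed.
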